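(* Let $d\ge2$, $2\le m\le d$, $\boldsymbol{x},\boldsymbol{y}\in\mathbb{R}^d$ and $v=\|\boldsymbol{x}+\boldsymbol{y}\|_2$. For the orthogonal coupling (ORFs), $$\rho_{\mathrm{ORF}}(\boldsymbol{x},\boldsymbol{y})=\frac{\Gamma(\frac d2)}{\Gamma(d)}\sum_{k=0}^\infty\frac{v^{2k}}{2^kk!}\frac{\Gamma(k+d)}{\Gamma(k+\frac d2)},$$ and for the simplex coupling (SimRFs), $$\rho_{\mathrm{SimRF}}(\boldsymbol{x},\boldsymbol{y})=\frac{\sqrt\pi}{\Gamma(\frac d2)2^{d-1}}\sum_{k=0}^\infty\frac{\Gamma(k+d)}{\Gamma(k+\frac d2)}\frac{v^{2k}}{2^k}\sum_{p=0}^k\Big(-\frac{1}{d-1}\Big)^p\frac{\Gamma(\frac{d+p}{2})}{\Gamma(\frac{d+p+1}{2})}\frac{1}{(k-p)!\,p!}.$$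
   Context: RF-conformity of random vectors $\boldsymbol{w}_1,\dots,\boldsymbol{w}_m$: $\rho(\boldsymbol{x},\boldsymbol{y})=\frac{\Gamma(d/2)}{m(m-1)}\sum_{i}\sum_{j\ne i}\mathbb{E}\big(\sum_{k\ge0}\frac{v^{2k}w_{ij}^{2k}}{2^{2k}k!\,\Gamma(k+d/2)}\big)$, $w_{ij}=\|\boldsymbol{w}_i+\boldsymbol{w}_j\|_2$. Let $w_1,\dots,w_d$ be i.i.d. $\chi_d$ and $\mathbf{R}$ Haar-distributed on $\mathrm{O}(d)$, independent. ORFs: $\boldsymbol{w}_i$ ($i\le m$) are rows of $\mathrm{diag}(w_1,\dots,w_d)\mathbf{R}$ (mutually orthogonal directions). SimRFs: $\boldsymbol{w}_i$ ($i\le m$) are rows of $\mathrm{diag}(w_1,\dots,w_d)\mathbf{S}\mathbf{R}$, where $\mathbf{S}$ has rows $\boldsymbol{s}_i=\sqrt{\frac{d}{d-1}}\mathbf{e}_i-\frac{\sqrt d+1}{(d-1)^{3/2}}(1,\dots,1,0)^\top$ ($1\le i<d$), $\boldsymbol{s}_d=\frac{1}{\sqrt{d-1}}(1,\dots,1,0)^\top$; these are unit vectors with pairwise inner product $-\frac1{d-1}$. *)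

(* Defs.v *)
From HB Require Import structures.
From mathcomp Require Import all_boot all_order all_algebra.
From mathcomp Require Import all_classical all_reals all_analysis.
Set Implicit Arguments.
Unset Strict Implicit.
Unset Printing Implicit Defensive.
Import Order.TTheory GRing.Theory Num.Theory.
Local Open Scope classical_set_scope.
Local Open Scope ring_scope.

Section Defs.
Variable R : realType.

Definition Gamma (s : R) : R :=
  fine (\int[@lebesgue_measure R]_(t in `]0%R, +oo[%classic)
          (powR t (s - 1) * expR (- t))%:E)%E.

Definition l2norm (n : nat) (u : 'rV[R]_n) : R :=
  Num.sqrt (\sum_(i < n) u 0 i ^+ 2).

Definition orthogonal_mx (n : nat) (M : 'M[R]_n) : Prop :=
  M *m M^T = 1%:M.

(* Borel sigma-algebra on 'M[R]_n (product sigma-algebra of the entries). *)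
Definition mx_coord_sets (n : nat) : set (set 'M[R]_n) :=
  [set A | exists (i j : 'I_n) (B : set R),
      measurable B /\ A = (fun M : 'M[R]_n => M i j) @^-1` B].
Definition mx_measurable (n : nat) : set (set 'M[R]_n) :=
  <<s @mx_coord_sets n >>.

(* Density of the chi distribution with d degrees of freedom (on x > 0). *)
Definition chi_pdf (d : nat) (x : R) : R :=
  x ^+ d.-1 * expR (- (x ^+ 2) / 2)
  / (powR 2 (d%:R / 2 - 1) * Gamma (d%:R / 2)).

(* The simplex matrix S (0-based indices; row d-1 is s_d). *)
Definition simplex_mx (d : nat) : 'M[R]_d :=
  \matrix_(i < d, j < d)
    let one_j : R := if (j < d.-1)%N then 1 else 0 in
    if (i < d.-1)%N then
      Num.sqrt (d%:R / (d%:R - 1)) * (i == j)%:R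
      - (Num.sqrt d%:R + 1) / (Num.sqrt (d%:R - 1) ^+ 3) * one_j
    else (Num.sqrt (d%:R - 1))^-1 * one_j.

(* Inner series of the RF-conformity, as an extended real (nonnegative terms):
   sum_k v^(2k) w^(2k) / (2^(2k) k! Gamma(k + d/2)). *)
Definition conf_series (d : nat) (v w : R) : \bar R :=
  (\sum_(0 <= k <oo)
     ((v ^+ (2 * k) * w ^+ (2 * k))
      / (2 ^+ (2 * k) * k`!%:R * Gamma (k%:R + d%:R / 2)))%:E)%E.

Definition rf_conformity (dT : measure_display) (Omega : measurableType dT)
    (P : probability Omega R) (d m : nat) (W : 'I_d -> Omega -> 'rV[R]_d)
    (v : R) : \bar R :=
  ((Gamma (d%:R / 2) / (m%:R * (m%:R - 1)))%:E *
   \sum_(i < d | (i < m)%N) \sum_(j < d | (j < m)%N && (j != i))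
      \int[P]_w conf_series d v (l2norm (W i w + W j w)))%E.

Definition chi_distributed (dT : measure_display) (Omega : measurableType dT)
    (P : probability Omega R) (d : nat) (X : Omega -> R) : Prop :=
  measurable_fun setT X /\
  forall A : set R, measurable A ->
    P (X @^-1` A) =
    (\int[@lebesgue_measure R]_(x in A `&` `]0%R, +oo[%classic) (chi_pdf d x)%:E)%E.

Definition haar_orthogonal (dT : measure_display) (Omega : measurableType dT)
    (P : probability Omega R) (d : nat) (Rm : Omega -> 'M[R]_d) : Prop :=
  (forall i j, measurable_fun setT (fun w => Rm w i j)) /\
  (forall w, orthogonal_mx (Rm w)) /\
  (forall Q : 'M[R]_d, orthogonal_mx Q ->
     forall B, mx_measurable B ->
       P ((fun w => Q *m Rm w) @^-1` B) = P (Rm @^-1` B)).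

Definition mutually_independent (dT : measure_display) (Omega : measurableType dT)
    (P : probability Omega R) (d : nat) (ws : 'I_d -> Omega -> R)
    (Rm : Omega -> 'M[R]_d) : Prop :=
  forall (A : 'I_d -> set R) (B : set 'M[R]_d),
    (forall i, measurable (A i)) -> mx_measurable B ->
    P ((\bigcap_(i in [set: 'I_d]) (ws i @^-1` A i)) `&` (Rm @^-1` B)) =
    ((\prod_(i < d) P (ws i @^-1` A i)) * P (Rm @^-1` B))%E.

End Defs.

(* Main.v *)
Require Import Defs.
From HB Require Import structures.
From mathcomp Require Import all_boot all_order all_algebra.
From mathcomp Require Import all_classical all_reals all_analysis.
From mathcomp Require Import measurable_realfun measurable_fun_approximation.
From mathcomp Require Import zify ring lra.
Import Order.TTheory GRing.Theory Num.Theory.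
Import numFieldNormedType.Exports.
Local Open Scope classical_set_scope.
Local Open Scope ring_scope.

(** Only the Gram matrix of the directions matters: since [R R^T = 1], for
    [i <> j] one has [w_ij^2 = w_i^2 + w_j^2 + 2 e w_i w_j], with [e = 0] for
    ORFs and [e = -1/(d-1)] for SimRFs.  Expanding the [k]-th power, using
    independence and the chi moments [2^(n/2) Gamma((n+d)/2) / Gamma(d/2)], the
    sum over the powers of [w_i^2] and [w_j^2] collapses by the Vandermonde
    identity for rising factorials (this replaces the Beta integral), leaving
    the sum over the power [p] of the cross term; the duplication formula then
    gives the stated coefficients.  Every Gamma value involved is at a
    half-integer, so the substitution [t = x^2/c] reduces all of them to moments
    of [exp(-x^2/c)] on the half-line, computed by integration by parts from
    the Gaussian integral. *)

(** * Rising factorials *)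

Definition rising (R : comNzRingType) (a : R) (n : nat) : R :=
  \prod_(i < n) (a + i%:R).
Arguments rising {R}.

Lemma risingS (R : comNzRingType) (a : R) n :
  rising a n.+1 = rising a n * (a + n%:R).
Proof. by rewrite /rising big_ord_recr. Qed.

(** Pascal's rule splits each binomial of order [n+1] in two; the factors [b + (n - i)] and [a + i]
    gained by the two halves add up to [a + b + n], the last factor of the left side. *)
Lemma rising_vandermonde (R : comNzRingType) (a b : R) n :
  rising (a + b) n = \sum_(i < n.+1) 'C(n, i)%:R * rising a i * rising b (n - i).
Proof.
elim: n => [|n IHn].
  by rewrite big_ord_recl big_ord0 /rising !big_ord0 /= bin0 !mulr1 addr0.
have step : \sum_(i < n.+2) 'C(n.+1, i)%:R * rising a i * rising b (n.+1 - i)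
  = \sum_(i < n.+1) 'C(n, i)%:R * rising a i * rising b (n.+1 - i)
  + \sum_(i < n.+1) 'C(n, i)%:R * rising a i.+1 * rising b (n - i).
  rewrite big_ord_recl /=.
  under eq_bigr do rewrite /bump /= add1n binS subSS natrD 2!mulrDl.
  rewrite big_split addrA; congr (_ + _).
  (* The extra index [n+1] is harmless: ['C(n, n.+1) = 0]. *)
  transitivity (\sum_(i < n.+2) 'C(n, i)%:R * rising a i * rising b (n.+1 - i)).
    rewrite [RHS]big_ord_recl /= !bin0; congr (_ + _); exact: eq_bigr.
  by rewrite big_ord_recr /= bin_small // mul0r mul0r addr0.
rewrite step risingS IHn mulr_suml -big_split; apply: eq_bigr => i _ /=.
have ilen : (i <= n)%N by rewrite -ltnS.
rewrite subSn // !risingS natrB //; ring.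
Qed.

(** * Gaussian moments and the Gamma function at half-integers *)

Section gauss_monomial.
Variable R : realType.

(** The scale [c] lets one family serve twice: [c = 1] yields the Gamma values at half-integers,
    [c = 2] the chi densities. *)
Definition gauss_mono (c : R) (n : nat) (x : R) : R :=
  x ^+ n * expR (- (x ^+ 2) / c).

Lemma gauss_mono_ge0 c n x : 0 <= x -> 0 <= gauss_mono c n x.
Proof. by move=> x0; rewrite mulr_ge0 ?exprn_ge0 ?expR_ge0. Qed.

Lemma is_derive_gauss (c x : R) :
  is_derive x 1 (fun x : R => - expR (- (x ^+ 2) / c)) (2 / c * gauss_mono c 1 x).
Proof.
have df : is_derive x 1 (fun x : R => - (x ^+ 2) / c) (- (2 * x) / c).
  by apply: is_derive_eq; rewrite /GRing.scale /=; ring.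
have dg := @is_derive1_comp R expR _ x _ _ (is_derive_expR _) df.
apply: is_derive_eq (is_deriveN dg) _.
by rewrite /gauss_mono /GRing.scale /=; ring.
Qed.

Lemma continuous_gauss_mono c n : continuous (gauss_mono c n).
Proof.
move=> x; rewrite /continuous_at /gauss_mono; apply: cvgM; first exact: exprn_continuous.
apply: (@continuous_comp _ _ _ (fun y : R => - (y ^+ 2) / c) expR x);
  last exact: continuous_expR.
apply: cvgM; last exact: cvg_cst.
by apply: cvgN; exact: exprn_continuous.
Qed.

Lemma measurable_gauss_mono c n : measurable_fun setT (gauss_mono c n).
Proof. by apply: continuous_measurable_fun; exact: continuous_gauss_mono. Qed.

(** One term of the exponential series gives [exp(x^2/c) >= x^(2n+2) / K], so for [x >= 1] the
    function lies between [0] and [K / x]. *)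
Lemma gauss_mono_cvg0 (c : R) n : 0 < c -> gauss_mono c n x @[x --> +oo] --> 0.
Proof.
move=> c0; set K := c ^+ n.+1 * n.+1`!%:R.
have K0 : 0 < K by rewrite mulr_gt0 ?exprn_gt0 // ltr0n fact_gt0.
apply: (@squeeze_cvgr _ _ _ _ (cst 0) (fun x => K * x^-1)).
- near=> x; have x1 : 1 <= x by near: x; apply: nbhs_pinfty_ge; rewrite num_real.
  have x0 : 0 < x by exact: lt_le_trans x1.
  rewrite gauss_mono_ge0 ?(ltW x0) //=.
  rewrite /gauss_mono mulNr expRN ler_pdivrMr ?expR_gt0 // mulrAC ler_pdivlMr //.
  rewrite -exprSr mulrC -ler_pdivrMr //.
  have := @expR_ge1Dxn R (x ^+ 2 / c) n (ltW (divr_gt0 (exprn_gt0 2 x0) c0)).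
  apply: le_trans; rewrite -[leLHS]add0r lerD //.
  rewrite expr_div_n -mulrA -invfM -/K ler_pM2r ?invr_gt0 //.
  by rewrite -exprM ler_weXn2l // leq_pmull.
- exact: cvg_cst.
- rewrite -[X in _ --> X](mulr0 K); apply: cvgMl_tmp.
  by apply/gtr0_cvgV0; [exact: nbhs_pinfty_gt|exact: cvg_id].
Unshelve. all: by end_near. Qed.

End gauss_monomial.

(** * Two-step recursion for the half-line moments of [exp(-x^2/c)] *)

Section gauss_moment_recursion.
Variable R : realType.
Notation mu := (@lebesgue_measure R).

Lemma is_derive_continuous (f df : R -> R) :
  (forall x : R, is_derive x 1 f (df x)) -> continuous f.
Proof.
by move=> dF x; have [dfx _] := dF x; exact/differentiable_continuous/derivable1_diffP.
Qed.

Lemma is_derive_oo_LRcontinuous (f df : R -> R) (a b : R) :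
  (forall x : R, is_derive x 1 f (df x)) -> derivable_oo_LRcontinuous f a b.
Proof.
move=> dF; have cf := is_derive_continuous _ _ dF.
split; first by move=> x _; have [] := dF x.
- by apply: cvg_at_right_filter; exact: cf.
- by apply: cvg_at_left_filter; exact: cf.
Qed.

Lemma is_derive_derive1 (f : R -> R) (df x : R) : is_derive x 1 f df -> derive1 f x = df.
Proof. by move=> [_]; rewrite derive1E. Qed.

(** Monotone convergence; the endpoint [N+1] keeps every interval nondegenerate, as integration by
    parts requires. *)
Lemma gauss_mono_cvg_integral (c : R) n :
  (\int[mu]_(x in `[0%R, N.+1%:R]) (gauss_mono R c n x)%:E @[N --> \oo] -->
   \int[mu]_(x in `[0%R, +oo[) (gauss_mono R c n x)%:E)%E.
Proof.
rewrite itv0y_bigcup0S.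
apply: (@ge0_nondecreasing_set_cvg_integral _ (measurableTypeR R) R
  (fun N => `[0, N.+1%:R]%classic)) => //.
- move=> i j ij; rewrite subsetEset; apply: subset_itvl.
  by rewrite bnd_simp ler_nat ltnS.
- by move=> i; apply/measurable_funTS/measurable_EFinP; exact: measurable_gauss_mono.
- move=> i x /=; rewrite in_itv /= => /andP[x0 _].
  by rewrite lee_fin; exact: gauss_mono_ge0.
Qed.

(** Integration by parts on [[0, N+1]], then [N] tends to infinity. The boundary term vanishes at
    [0] through the factor [x^(n+1)] and at [N+1] in the limit by Gaussian decay. *)
Lemma gauss_mono_rec (c : R) n : 0 < c ->
  (\int[mu]_(x in `[0%R, +oo[) (gauss_mono R c n.+2 x)%:E =
   (n.+1%:R * c / 2)%:E * \int[mu]_(x in `[0%R, +oo[) (gauss_mono R c n x)%:E)%E.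
Proof.
move=> c0; have c_neq0 : c != 0 by rewrite gt_eqF.
pose e (x : R) := - expR (- (x ^+ 2) / c).
have parts (N : nat) : (\int[mu]_(x in `[0%R, N.+1%:R]) (gauss_mono R c n.+2 x)%:E =
   (- (c / 2) * gauss_mono R c n.+1 N.+1%:R)%:E + (n.+1%:R * c / 2)%:E *
   \int[mu]_(x in `[0%R, N.+1%:R]) (gauss_mono R c n x)%:E)%E.
  (* The polynomial factor carries [c / 2] to cancel the [2 / c] in the derivative of [e]. *)
  have dX (x : R) : is_derive x 1 (fun x : R => c / 2 * x ^+ n.+1) (c / 2 * (n.+1%:R * x ^+ n)).
    have -> : (fun x : R => c / 2 * x ^+ n.+1) = (c / 2) *: ((@id R) ^+ n.+1).
      by apply/funext => y; rewrite exprfctE.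
    by apply: is_derive_eq; rewrite /GRing.scale /=; ring.
  have cX : continuous (fun x : R => c / 2 * (n.+1%:R * x ^+ n)).
    by move=> x; apply: cvgMl_tmp; apply: cvgMl_tmp; exact: exprn_continuous.
  have cg : continuous (fun x : R => 2 / c * gauss_mono R c 1 x).
    by move=> x; apply: cvgMl_tmp; exact: continuous_gauss_mono.
  have := @integration_by_parts R _ e _ _ 0 N.+1%:R (ltr0Sn _ _)
    (continuous_subspaceT cX)
    (is_derive_oo_LRcontinuous _ _ _ _ dX)
    (fun x _ => is_derive_derive1 _ _ _ (dX x))
    (continuous_subspaceT cg)
    (is_derive_oo_LRcontinuous _ _ _ _ (is_derive_gauss R c))
    (fun x _ => is_derive_derive1 _ _ _ (is_derive_gauss R c x)).
  under eq_integral => x _.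
    rewrite (_ : _ * _ = gauss_mono R c n.+2 x); last first.
      rewrite /gauss_mono expr1 (exprSr x n.+1).
      by set E := expR _; set y := x ^+ n.+1; field.
    over.
  move=> ->; rewrite (_ : _ - _ = - (c / 2) * gauss_mono R c n.+1 N.+1%:R); last first.
    by rewrite expr0n /= mulr0 mul0r subr0 /e /gauss_mono; ring.
  congr (_ + _)%E.
  rewrite -ge0_integralZl_EFin //=; last 3 first.
  - move=> x; rewrite in_itv /= => /andP[x0 _].
    by rewrite lee_fin; exact: gauss_mono_ge0.
  - by apply/measurable_funTS/measurable_EFinP; exact: measurable_gauss_mono.
  - by rewrite !mulr_ge0 // ltW.
  (* As [e] is negative, the remaining integrand is nonpositive; pulling its sign out cancels the
     minus of the by-parts formula. *)
  transitivity (- \int[mu]_(x in `[0%R, N.+1%:R])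
      - ((n.+1%:R * c / 2)%:E * (gauss_mono R c n x)%:E))%E.
    congr (- _)%E; apply: eq_integral => x _; rewrite -EFinM -EFinN; congr EFin.
    by rewrite /e /gauss_mono; ring.
  rewrite integral_ge0N ?oppeK // => x; rewrite /= in_itv /= => /andP[x0 _].
  by rewrite -EFinM lee_fin mulr_ge0 ?gauss_mono_ge0 // !mulr_ge0 // ltW.
have h1 : (\int[mu]_(x in `[0%R, N.+1%:R]) (gauss_mono R c n.+2 x)%:E @[N --> \oo] -->
  0 + (n.+1%:R * c / 2)%:E * \int[mu]_(x in `[0%R, +oo[) (gauss_mono R c n x)%:E)%E.
  under eq_fun do rewrite parts.
  apply: cvgeD.
  - by rewrite fin_num_adde_defr.
  - apply: cvg_EFin; first by near=> N.
    rewrite -[X in _ --> X](mulr0 (- (c / 2))); apply: cvgMl_tmp.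
    have /cvg_pinftyP := gauss_mono_cvg0 R c n.+1 c0; apply.
    by apply/cvgryPge => A; near=> N; apply: le_trans (_ : N%:R <= _);
      [near: N; exact: nbhs_infty_ger|rewrite ler_nat].
  - by apply: cvgeZl => //; exact: gauss_mono_cvg_integral.
rewrite -[RHS]add0e; apply: cvg_unique h1; last exact: gauss_mono_cvg_integral.
exact: ereal_hausdorff.
Unshelve. all: by end_near. Qed.

(** The odd base case of the recursion: here [-(c/2) exp(-x^2/c)] is a primitive. *)
Lemma gauss_mono1 (c : R) : 0 < c ->
  (\int[mu]_(x in `[0%R, +oo[) (gauss_mono R c 1 x)%:E = (c / 2)%:E)%E.
Proof.
move=> c0; have c_neq0 : c != 0 by rewrite gt_eqF.
have ide (x : R) : is_derive x 1 (fun x : R => (c / 2) * - expR (- (x ^+ 2) / c))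
    (gauss_mono R c 1 x).
  have := is_derive_gauss R c x => dg.
  apply: is_derive_eq (is_deriveZ _ dg) _.
  by rewrite /GRing.scale /=; field.
have idc := is_derive_continuous _ _ ide.
rewrite (@ge0_continuous_FTC2y R _ (fun x => (c / 2) * - expR (- (x ^+ 2) / c)) 0 0).
- by rewrite expr0n /= oppr0 mul0r expR0 mulrN1 -EFinB sub0r opprK.
- by move=> x x0; exact: gauss_mono_ge0.
- by apply: continuous_subspaceT; exact: continuous_gauss_mono.
- rewrite -[X in _ --> X](mulr0 (c / 2)); apply: cvgMl_tmp.
  rewrite -oppr0; apply: cvgN.
  have := gauss_mono_cvg0 R c 0 c0.
  by apply: cvg_trans; apply: near_eq_cvg; near=> x; rewrite /gauss_mono expr0 mul1r.
- by move=> x _; have [] := ide x.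
- by apply: cvg_at_right_filter; exact: idc.
- by move=> x _; exact: is_derive_derive1.
Unshelve. all: by end_near. Qed.

End gauss_moment_recursion.

(** * The substitution [x = sqrt(c t)] between Gaussian moments and Gamma integrals *)

Section gauss_gamma_substitution.
Variable R : realType.
Notation mu := (@lebesgue_measure R).

Lemma is_derive_scaled_sqrt (k t : R) : 0 < t ->
  is_derive t 1 (fun t => k * Num.sqrt t) (k * (2 * Num.sqrt t)^-1).
Proof.
move=> t0; have -> : (fun t => k * Num.sqrt t) = k *: (@Num.sqrt R) by [].
by apply: is_derive_eq (is_deriveZ _ (is_derive1_sqrt t0)) _.
Qed.

Lemma gauss_mono_sqrt (c t : R) n : 0 < c -> 0 < t ->
  gauss_mono R c n (Num.sqrt c * Num.sqrt t) * (Num.sqrt c * (2 * Num.sqrt t)^-1) =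
  Num.sqrt c ^+ n.+1 / 2 * (powR t (n.+1%:R / 2 - 1) * expR (- t)).
Proof.
move=> c0 t0; rewrite /gauss_mono !exprMn !sqr_sqrtr ?ltW //.
have -> : - (c * t) / c = - t by field; rewrite gt_eqF.
have -> : powR t (n.+1%:R / 2 - 1) = Num.sqrt t ^+ n / Num.sqrt t.
  rewrite -powR12_sqrt ?ltW // -powR_mulrn ?powR_ge0 // -powRrM -powRB.
    by congr powR; rewrite -natr1; field.
  by apply/implyP => _; rewrite gt_eqF.
by rewrite exprS; field; rewrite gt_eqF // sqrtr_gt0.
Qed.

Lemma sqrt_cvgy : Num.sqrt x @[x --> +oo%R] --> (+oo%R : set_system R).
Proof.
apply/cvgryPge => A; near=> x.
have [A0|A0] := leP A 0; first exact: le_trans A0 (sqrtr_ge0 _).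
rewrite -(ler_pXn2r (n := 2)) ?nnegrE ?sqrtr_ge0 ?(ltW A0) // sqr_sqrtr.
  by near: x; apply: nbhs_pinfty_ge; rewrite num_real.
by near: x; apply: nbhs_pinfty_ge; rewrite num_real.
Unshelve. all: by end_near. Qed.

(** The lower bound [a] is kept positive because the derivative of the square root has no finite
    limit at [0], which the substitution rule asks for. *)
Lemma gauss_mono_subst_from (c a : R) n : 0 < c -> 0 < a ->
  (\int[mu]_(x in `[(Num.sqrt c * Num.sqrt a)%R, +oo[) (gauss_mono R c n x)%:E =
   \int[mu]_(t in `[a, +oo[) (Num.sqrt c ^+ n.+1 / 2 *
     (powR t (n.+1%:R / 2 - 1) * expR (- t)))%:E)%E.
Proof.
move=> c0 a0.
pose F (t : R) : R := Num.sqrt c * Num.sqrt t.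
pose F' (t : R) : R := Num.sqrt c * (2 * Num.sqrt t)^-1.
have sc0 : 0 < Num.sqrt c by rewrite sqrtr_gt0.
have dF (t : R) : 0 < t -> is_derive t 1 F (F' t) by exact: is_derive_scaled_sqrt.
have F'E (t : R) : 0 < t -> derive1 F t = F' t by move=> /dF /is_derive_derive1.
have F'cont (t : R) : 0 < t -> {for t, continuous F'}.
  move=> t0; rewrite /F'; apply: cvgMl_tmp; apply: cvgV.
    by rewrite mulf_neq0 // gt_eqF // sqrtr_gt0.
  by apply: cvgMl_tmp; exact: sqrt_continuous.
have Fcont : continuous F by move=> t; apply: cvgMl_tmp; exact: sqrt_continuous.
have near_F' (t : R) : 0 < t -> \forall x \near t, F' x = derive1 F x.
  by move=> t0; near=> x; rewrite F'E //; near: x; exact: lt_nbhsr.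
rewrite (@increasing_ge0_integration_by_substitutiony R F (gauss_mono R c n) a).
- apply: eq_integral => t; rewrite inE /= in_itv /= andbT => at_.
  have t0 := lt_le_trans a0 at_.
  by rewrite -gauss_mono_sqrt // fctE /= F'E.
- move=> x y; rewrite !in_itv /= !andbT => ax ay xy.
  by rewrite /F ltr_pM2l // ltr_sqrt // (lt_trans _ xy) // (lt_le_trans a0).
- move=> t; rewrite in_itv /= andbT => at_; have t0 := lt_trans a0 at_.
  rewrite /prop_for /continuous_at F'E //; apply: cvg_trans (F'cont t t0).
  by apply: near_eq_cvg; exact: near_F'.
- apply/cvg_ex; exists (F' a).
  have := cvg_at_right_filter (F'cont a a0); apply: cvg_trans.
  by apply: near_eq_cvg; apply: cvg_within; exact: near_F'.
- apply/cvg_ex; exists 0.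
  apply: (@cvg_trans _ (F' x @[x --> +oo%R])).
    by apply: near_eq_cvg; near=> x; rewrite F'E //; near: x; exact: nbhs_pinfty_gt.
  suff : F' x @[x --> +oo%R] --> Num.sqrt c * 0 by rewrite mulr0.
  apply: cvgMl_tmp; apply/gtr0_cvgV0; first by near=> x; rewrite mulr_gt0 // sqrtr_gt0.
  by apply: gt0_cvgMry => //; exact: sqrt_cvgy.
- split; last by apply: cvg_at_right_filter; exact: Fcont.
  move=> t; rewrite in_itv /= andbT => at_.
  by have [] := dF t (lt_trans a0 at_).
- by apply: gt0_cvgMry => //; exact: sqrt_cvgy.
- by apply: continuous_subspaceT; exact: continuous_gauss_mono.
- move=> x; rewrite in_itv /= andbT => /ltW Fx.
  by apply: gauss_mono_ge0; apply: le_trans Fx; rewrite mulr_ge0 ?sqrtr_ge0.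
Unshelve. all: by end_near. Qed.

Lemma gamma_integrand_ge0 (s t : R) : 0 <= powR t s * expR (- t).
Proof. by rewrite mulr_ge0 ?powR_ge0 ?expR_ge0. Qed.

Lemma measurable_gamma_integrand (s : R) (D : set R) : measurable D ->
  measurable_fun D (fun t : R => powR t s * expR (- t)).
Proof.
move=> mD; apply: measurable_funTS; apply: measurable_funM => //.
by apply: measurableT_comp => //; exact: measurable_funN.
Qed.

(** Letting the lower bound [a k] decrease to [0], monotone convergence gives both sides as limits
    of the same sequence. The identity lives in the extended reals, so finiteness of the Gamma
    integral can later be deduced from it. *)
Lemma gauss_mono_integralE (c : R) n : 0 < c ->
  (\int[mu]_(x in `[0%R, +oo[) (gauss_mono R c n x)%:E =
   (Num.sqrt c ^+ n.+1 / 2)%:E *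
   \int[mu]_(t in `]0%R, +oo[) (powR t (n.+1%:R / 2 - 1) * expR (- t))%:E)%E.
Proof.
move=> c0; have sc0 : 0 < Num.sqrt c by rewrite sqrtr_gt0.
pose a (k : nat) : R := 0 + k.+1%:R^-1.
have a_gt0 k : 0 < a k by rewrite /a add0r invr_gt0.
have a_le i j : (i <= j)%N -> a j <= a i.
  by move=> ij; rewrite /a !add0r lef_pV2 ?posrE // ler_nat.
rewrite -integral_itv_obnd_cbnd; last first.
  by apply/measurable_EFinP/measurable_funTS; exact: measurable_gauss_mono.
rewrite -ge0_integralZl_EFin //=; last 2 first.
- by move=> t _; rewrite lee_fin gamma_integrand_ge0.
- by apply/measurable_EFinP; exact: measurable_gamma_integrand.
(* The images of the rays [[a k, +oo[] also exhaust the half-line: [x] is reached as soon as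
   [a k <= x^2 / c]. *)
have E : `]0%R, +oo[%classic =
    \bigcup_k `[(Num.sqrt c * Num.sqrt (a k))%R, +oo[%classic.
  apply/seteqP; split=> x /=; rewrite in_itv /= andbT.
    move=> x0; have : `]0%R, +oo[%classic (x ^+ 2 / c).
      by rewrite /= in_itv /= andbT divr_gt0 // exprn_gt0.
    rewrite itvoyEbigcup => -[k _ /=]; rewrite in_itv /= andbT => akx.
    exists k => //=; rewrite in_itv /= andbT -sqrtrM ?(ltW c0) //.
    rewrite -[leRHS](ger0_norm (ltW x0)) -sqrtr_sqr ler_sqrt ?exprn_gt0 ?exprn_ge0 ?(ltW x0) //.
    by rewrite mulrC -ler_pdivlMr.
  move=> [k _ /=]; rewrite in_itv /= andbT; apply: lt_le_trans.
  by rewrite mulr_gt0 // sqrtr_gt0.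
rewrite {1}E {E}.
have L : (\int[mu]_(x in `[(Num.sqrt c * Num.sqrt (a k))%R, +oo[) (gauss_mono R c n x)%:E
   @[k --> \oo] --> \int[mu]_(x in \bigcup_k `[(Num.sqrt c * Num.sqrt (a k))%R, +oo[%classic)
   (gauss_mono R c n x)%:E)%E.
  apply: (@ge0_nondecreasing_set_cvg_integral _ (measurableTypeR R) R
    (fun k => `[(Num.sqrt c * Num.sqrt (a k)), +oo[%classic)) => //.
  - move=> i j ij; rewrite subsetEset; apply: subset_itvr; rewrite bnd_simp.
    by rewrite ler_pM2l // ler_sqrt ?a_le // ltW.
  - by move=> i; apply/measurable_funTS/measurable_EFinP; exact: measurable_gauss_mono.
  - move=> i x /=; rewrite in_itv /= andbT => x0; rewrite lee_fin.
    by apply: gauss_mono_ge0; apply: le_trans x0; rewrite mulr_ge0 ?sqrtr_ge0.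
apply: (cvg_unique _ L) => //.
rewrite /=; under eq_fun do rewrite gauss_mono_subst_from //.
rewrite itvoyEbigcup.
apply: (@ge0_nondecreasing_set_cvg_integral _ (measurableTypeR R) R
    (fun k => `[a k, +oo[%classic)) => //.
- move=> i j ij; rewrite subsetEset; apply: subset_itvr; rewrite bnd_simp.
  exact: a_le.
- move=> i; apply/measurable_EFinP; apply: measurable_funM => //.
  exact: measurable_gamma_integrand.
- move=> i x _; rewrite lee_fin mulr_ge0 ?gamma_integrand_ge0 //.
Qed.

End gauss_gamma_substitution.

(** * The Gamma function at half-integers: values, recursion, duplication, convolution *)

Section half_integer_gamma.
Variable R : realType.
Notation mu := (@lebesgue_measure R).

(** Fits the recursion from [n] to [n+2], with one base case per parity. *)
Lemma nat_ind2 (Q : nat -> Prop) :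
  Q 0%N -> Q 1%N -> (forall n, Q n -> Q n.+2) -> forall n, Q n.
Proof.
move=> Q0 Q1 QS n; suff : Q n /\ Q n.+1 by case.
by elim: n => [|n [Qn QSn]]; split=> //; exact: QS.
Qed.

Lemma gauss_mono0 :
  (\int[mu]_(x in `[0%R, +oo[) (gauss_mono R 1 0 x)%:E = (Num.sqrt pi / 2)%:E)%E.
Proof.
rewrite -integral0y_gauss; apply: eq_integral => x _.
by rewrite /gauss_mono /gauss_fun expr0 mul1r divr1.
Qed.

Lemma gauss_mono_fin_num n :
  (\int[mu]_(x in `[0%R, +oo[) (gauss_mono R 1 n x)%:E)%E \is a fin_num.
Proof.
elim/nat_ind2: n => [||n IHn]; first by rewrite gauss_mono0.
  by rewrite gauss_mono1.
by rewrite gauss_mono_rec // fin_numM.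
Qed.

(** [Gamma] is defined through [fine], which would send an infinite integral to [0]; finiteness of
    the Gaussian moments rules this out at positive half-integers. *)
Lemma Gamma_halfE n : (Gamma (n.+1%:R / 2 : R))%:E =
  (\int[mu]_(t in `]0%R, +oo[) (powR t (n.+1%:R / 2 - 1) * expR (- t))%:E)%E.
Proof.
rewrite /Gamma fineK //.
have := gauss_mono_fin_num n; rewrite gauss_mono_integralE // sqrtr1 expr1n.
set I := (\int[_]_(_ in _) _)%E => fI.
have -> : I = (2%:E * ((1 / 2)%:E * I))%E.
  by rewrite muleA -EFinM mul1r mulfV ?mul1e // pnatr_eq0.
by rewrite fin_numM.
Qed.

Lemma gauss_mono_integral (c : R) n : 0 < c ->
  (\int[mu]_(x in `[0%R, +oo[) (gauss_mono R c n x)%:E =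
   (Num.sqrt c ^+ n.+1 / 2 * Gamma (n.+1%:R / 2))%:E)%E.
Proof. by move=> c0; rewrite gauss_mono_integralE // -Gamma_halfE. Qed.

(** Indexing by twice the argument keeps all indices natural: [half_Gamma n.*2] is [Gamma] at
    [n]. *)
Definition half_Gamma (n : nat) : R := Gamma (n%:R / 2).

Lemma half_Gamma1 : half_Gamma 1 = Num.sqrt pi.
Proof.
have := gauss_mono0; rewrite gauss_mono_integral // sqrtr1 expr1n => -[].
rewrite -/(half_Gamma 1); lra.
Qed.

Lemma half_Gamma2 : half_Gamma 2 = 1.
Proof.
have := gauss_mono1 R 1 ltr01; rewrite gauss_mono_integral // sqrtr1 expr1n => -[].
rewrite -/(half_Gamma 2); lra.
Qed.

(** The functional equation [Gamma(s+1) = s Gamma(s)] at [s = (n+1)/2], read off the moment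
    recursion with [c = 1]. *)
Lemma half_GammaS n : half_Gamma n.+3 = n.+1%:R / 2 * half_Gamma n.+1.
Proof.
have := gauss_mono_rec R 1 n ltr01; rewrite !gauss_mono_integral // !sqrtr1 !expr1n => -[].
rewrite -!/(half_Gamma _); lra.
Qed.

Lemma half_Gamma_gt0 n : 0 < half_Gamma n.+1.
Proof.
elim/nat_ind2: n => [||n IHn]; first by rewrite half_Gamma1 sqrtr_gt0 pi_gt0.
  by rewrite half_Gamma2.
by rewrite half_GammaS mulr_gt0 // divr_gt0.
Qed.

Lemma half_Gamma_neq0 n : (0 < n)%N -> half_Gamma n != 0.
Proof. by case: n => // n _; rewrite gt_eqF // half_Gamma_gt0. Qed.

Lemma half_Gamma_rising n k : (0 < n)%N ->
  half_Gamma (n + k.*2) = rising (n%:R / 2) k * half_Gamma n.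
Proof.
case: n => // n _; elim: k => [|k IHk].
  by rewrite addn0 /rising big_ord0 mul1r.
rewrite doubleS !addnS !addSn half_GammaS risingS -addSn IHk.
by rewrite natrD -muln2 natrM; field.
Qed.

(** Legendre's duplication formula: passing from [n] to [n+1] multiplies both sides by [n]. *)
Lemma half_Gamma_duplication n : (0 < n)%N ->
  half_Gamma n * half_Gamma n.+1 * 2 ^+ n = 2 * Num.sqrt pi * half_Gamma n.*2.
Proof.
case: n => // n _; elim: n => [|n IHn].
  by rewrite half_Gamma1 half_Gamma2; ring.
rewrite doubleS doubleS half_GammaS half_GammaS.
transitivity (n.+1%:R * (half_Gamma n.+1 * half_Gamma n.+2 * 2 ^+ n.+1)).
  by rewrite (exprS _ n.+1); field.
have e : (n.*2.+2)%:R = n.+1%:R * 2 :> R by rewrite -doubleS -muln2 natrM.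
by rewrite IHn doubleS e; field.
Qed.

(** Factoring out [half_Gamma n ^+ 2] turns each summand into rising factorials of [n/2]; the sum is
    then Vandermonde's with [a = b = n/2]. *)
Lemma half_Gamma_convolution n k : (0 < n)%N ->
  (\sum_(i < k.+1) 'C(k, i)%:R * half_Gamma (n + i.*2) * half_Gamma (n + (k - i).*2))
  * half_Gamma n.*2 = half_Gamma n ^+ 2 * half_Gamma (n.*2 + k.*2).
Proof.
move=> n0; have dn0 : (0 < n.*2)%N by rewrite double_gt0.
rewrite half_Gamma_rising // -[in n.*2%:R / 2]muln2 natrM mulfK ?pnatr_eq0 //.
have -> : n%:R = n%:R / 2 + n%:R / 2 :> R by field.
rewrite rising_vandermonde [RHS]mulrA; congr (_ * _).
rewrite mulr_sumr; apply: eq_bigr => i _.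
by rewrite !half_Gamma_rising //; ring.
Qed.

End half_integer_gamma.

(** * Moments of independent chi variables *)

Section integral_density.
Local Open Scope ereal_scope.
Context d (T : measurableType d) (R : realType).
Variables (nu mu : {measure set T -> \bar R}) (D : set T) (g : T -> R).
Hypothesis mD : measurable D.
Hypothesis mg : measurable_fun D g.
Hypothesis g_ge0 : forall x, D x -> (0 <= g x)%R.
Hypothesis nuE : forall A, measurable A -> nu A = \int[mu]_(x in A `&` D) (g x)%:E.

Import HBNNSimple.

(** Linearity reduces the claim to indicator functions, where it is the hypothesis [nuE]. *)
Lemma ge0_integral_density_nnsfun (h : {nnsfun T >-> R}) :
  \int[nu]_x (h x)%:E = \int[mu]_(x in D) ((h x)%:E * (g x)%:E).
Proof.
transitivity (\sum_(k \in range h)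
    \int[nu]_x (k%:E * (\1_(h @^-1` [set k]) x)%:E)).
  under eq_integral do rewrite fimfunE -fsumEFin //.
  under eq_integral do under eq_fsbigr do rewrite EFinM.
  rewrite ge0_integral_fsum //.
  - by move=> y; apply: emeasurable_funM => //; exact/measurable_EFinP.
  - by move=> y x _; rewrite nnfun_muleindic_ge0.
transitivity (\sum_(k \in range h)
    \int[mu]_(x in D) ((k%:E * (\1_(h @^-1` [set k]) x)%:E) * (g x)%:E)); last first.
  rewrite -ge0_integral_fsum //; last 2 first.
  - move=> k; apply: emeasurable_funM.
      by apply/measurable_EFinP/measurable_funTS/measurable_funM.
    exact/measurable_EFinP.
  - move=> k x Dx; apply: mule_ge0; first exact: nnfun_muleindic_ge0.
    by rewrite lee_fin g_ge0.
  apply: eq_integral => x _; rewrite -ge0_mule_fsuml.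
    by rewrite fsumEFin // -fimfunE.
  by move=> k; rewrite nnfun_muleindic_ge0.
apply: eq_fsbigr => k _.
have mhk : measurable (h @^-1` [set k]) by [].
rewrite integralZl_indic_nnsfun // integral_indic // setIT nuE //.
(* A nonnegative [h] takes no negative value [k], so both sides vanish in that case. *)
have [k0|k0] := ltP k 0%R.
  by rewrite preimage_nnfun0 // set0I integral_set0 mule0 integral0_eq // => x _;
    rewrite indicE in_set0 mule0 mul0e.
under [RHS]eq_integral do rewrite -muleA.
rewrite ge0_integralZl_EFin //; last 2 first.
- by move=> x Dx; rewrite mule_ge0 ?lee_fin ?g_ge0.
- by apply: emeasurable_funM; apply/measurable_EFinP => //; exact: measurable_funTS.
congr (_ * _); rewrite setIC integral_mkcondr; apply: eq_integral => x _.
by rewrite patchE indicE; case: ifPn => _; rewrite ?mul1e ?mul0e.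
Qed.

Lemma ge0_integral_density (f : T -> \bar R) : measurable_fun setT f ->
  (forall x, 0 <= f x) -> \int[nu]_x f x = \int[mu]_(x in D) (f x * (g x)%:E).
Proof.
move=> mf f0; pose f_ := nnsfun_approx measurableT mf.
have f_cvg x : (f_ n x)%:E @[n --> \oo] --> f x by exact: cvg_nnsfun_approx.
transitivity (limn (fun n => \int[nu]_x (f_ n x)%:E)).
  rewrite -monotone_convergence //.
  - by apply: eq_integral => x _; apply/esym/cvg_lim => //; exact: f_cvg.
  - by move=> n; exact/measurable_EFinP.
  - by move=> n x _; rewrite lee_fin.
  - by move=> x _ m n mn; rewrite lee_fin; exact/lefP/nd_nnsfun_approx.
transitivity (limn (fun n => \int[mu]_(x in D) ((f_ n x)%:E * (g x)%:E))).
  by congr (limn _); apply/funext => n; exact: ge0_integral_density_nnsfun.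
rewrite -monotone_convergence //.
- apply: eq_integral => x _; apply/cvg_lim => //.
  by apply: cvgeZr => //; exact: f_cvg.
- move=> n; apply: emeasurable_funM; apply/measurable_EFinP => //.
  exact: measurable_funTS.
- by move=> n x Dx; rewrite mule_ge0 ?lee_fin ?g_ge0.
- move=> x Dx m n mn; apply: lee_wpmul2r; first by rewrite lee_fin g_ge0.
  by rewrite lee_fin; exact/lefP/nd_nnsfun_approx.
Qed.

End integral_density.

(** * Expectations over two independent variables as iterated integrals *)

Section independent_pair.
Local Open Scope ereal_scope.
Context d (T : measurableType d) (R : realType) (P : probability T R).
Variables X Y : {mfun T >-> R}.
Hypothesis XY : forall A B : set R, measurable A -> measurable B ->
  P (X @^-1` A `&` Y @^-1` B) = P (X @^-1` A) * P (Y @^-1` B).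

(** A product of probability measures is determined by its values on rectangles, so independence
    makes the joint law of [(X, Y)] the product of the marginals; Tonelli's theorem concludes. *)
Lemma ge0_integral_independent_pair (h : R -> R -> \bar R) :
  measurable_fun setT (fun z : R * R => h z.1 z.2) -> (forall x y, 0 <= h x y) ->
  \int[P]_w h (X w) (Y w) =
  \int[distribution P X]_x \int[distribution P Y]_y h x y.
Proof.
move=> mh h0.
pose phi w := (X w, Y w).
have mphi : measurable_fun setT phi by exact: measurable_fun_pair.
pose Z : {mfun T >-> (R * R)%type} := mfun_Sub (mem_set mphi).
transitivity (\int[distribution P Z]_z h z.1 z.2).
  by rewrite ge0_integral_distribution // => -[x y]; exact: h0.
transitivity (\int[distribution P X \x distribution P Y]_z h z.1 z.2).
  apply: eq_measure_integral => A mA _; apply/esym.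
  apply: product_measure_unique => // B C mB mC.
by rewrite (fubini_tonelli1 (fun z => h z.1 z.2)) // => z; exact: h0.
Qed.

End independent_pair.

(** * Chi moments and expectations of polynomials in two chi variables *)

Section chi_moments.
Variable R : realType.
Notation mu := (@lebesgue_measure R).
Notation posR := (`]0%R, +oo[%classic : set R).

Definition chi_moment (d n : nat) : R :=
  Num.sqrt 2 ^+ n * half_Gamma R (n + d) / half_Gamma R d.

Lemma expr_gauss_mono (c : R) m n x :
  x ^+ m * gauss_mono R c n x = gauss_mono R c (m + n) x.
Proof. by rewrite /gauss_mono mulrA exprD. Qed.

Lemma chi_pdfE d (x : R) : (0 < d)%N ->
  chi_pdf d x = (Num.sqrt 2 ^+ d / 2 * half_Gamma R d)^-1 * gauss_mono R 2 d.-1 x.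
Proof.
move=> d0; have e : powR 2 (d%:R / 2 - 1) = Num.sqrt 2 ^+ d / 2 :> R.
  rewrite powRB ?pnatr_eq0 ?implybT //.
  by rewrite powRr1 // (mulrC d%:R) powRrM powR12_sqrt // powR_mulrn ?sqrtr_ge0 //.
by rewrite /chi_pdf e mulrC.
Qed.

Lemma measurable_chi_pdf d : (0 < d)%N -> measurable_fun setT (@chi_pdf R d).
Proof.
move=> d0; rewrite (_ : chi_pdf d = fun x =>
    (Num.sqrt 2 ^+ d / 2 * half_Gamma R d)^-1 * gauss_mono R 2 d.-1 x); last first.
  by apply/funext => x; exact: chi_pdfE.
by apply: measurable_funM => //; exact: measurable_gauss_mono.
Qed.

Lemma chi_pdf_ge0 d (x : R) : (0 < d)%N -> posR x -> 0 <= chi_pdf d x.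
Proof.
move=> d0; rewrite /= in_itv /= andbT => x0; rewrite chi_pdfE //.
rewrite mulr_ge0 ?gauss_mono_ge0 ?(ltW x0) // invr_ge0 mulr_ge0 ?divr_ge0 ?exprn_ge0 //.
by case: d d0 => // d _; rewrite ltW // half_Gamma_gt0.
Qed.

(** Multiplying the density by [x^n] gives, up to the normalising constant, the Gaussian monomial of
    degree [n + d - 1] with [c = 2], whose integral is a Gamma value. *)
Lemma integral_expr_chi_pdf d n : (0 < d)%N ->
  (\int[mu]_(x in posR) (x ^+ n * chi_pdf d x)%:E = (chi_moment d n)%:E)%E.
Proof.
move=> d0; set c := (Num.sqrt 2 ^+ d / 2 * half_Gamma R d)^-1.
have c_ge0 : 0 <= c.
  rewrite invr_ge0 mulr_ge0 ?divr_ge0 ?exprn_ge0 //.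
  by case: d d0 @c => // d _ _; rewrite ltW // half_Gamma_gt0.
under eq_integral => x _.
  rewrite chi_pdfE // -/c mulrCA expr_gauss_mono EFinM.
  over.
rewrite ge0_integralZl_EFin //; last 2 first.
- move=> x; rewrite /= in_itv /= andbT => x0.
  by rewrite lee_fin gauss_mono_ge0 // ltW.
- by apply/measurable_EFinP/measurable_funTS; exact: measurable_gauss_mono.
rewrite integral_itv_obnd_cbnd; last first.
  by apply/measurable_EFinP/measurable_funTS; exact: measurable_gauss_mono.
rewrite gauss_mono_integral // -EFinM; congr EFin.
have nd : (n + d.-1).+1 = (n + d)%N by rewrite -addnS prednK.
rewrite nd -/(half_Gamma R (n + d)) /c /chi_moment exprD; field.
by rewrite half_Gamma_neq0 // expf_neq0 // gt_eqF // sqrtr_gt0.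
Qed.

Lemma integrable_expr_chi_pdf d n : (0 < d)%N ->
  mu.-integrable posR (EFin \o (fun x : R => x ^+ n * chi_pdf d x)).
Proof.
move=> d0; apply/integrableP; split.
  apply/measurable_EFinP/measurable_funTS; apply: measurable_funM.
    exact: exprn_measurable.
  exact: measurable_chi_pdf.
under eq_integral => x.
  rewrite inE => x0 /=; rewrite ger0_norm; last first.
    rewrite mulr_ge0 ?chi_pdf_ge0 // exprn_ge0 //.
    by move: x0; rewrite /= in_itv /= andbT => /ltW.
  over.
by rewrite integral_expr_chi_pdf // ltry.
Qed.

(** The coefficients may have any sign, so linearity goes through the integrability of each
    monomial. *)
Lemma integral_sum_expr_chi_pdf d (I : finType) (c : I -> R) (a : I -> nat) :
  (0 < d)%N ->
  (\int[mu]_(x in posR) ((\sum_i c i * x ^+ a i) * chi_pdf d x)%:E =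
   (\sum_i c i * chi_moment d (a i))%:E)%E.
Proof.
move=> d0; under eq_integral => x _.
  rewrite mulr_suml -sumEFin.
  under eq_bigr => i _ do rewrite -mulrA EFinM.
  over.
rewrite integral_sum //; last first.
  by move=> i; apply: integrableZl => //; exact: integrable_expr_chi_pdf.
rewrite -sumEFin; apply: eq_bigr => i _; rewrite integralZl //.
  by rewrite integral_expr_chi_pdf.
exact: integrable_expr_chi_pdf.
Qed.

Lemma ge0_integral_chi_distributed (dT : measure_display)
    (Omega : measurableType dT) (P : probability Omega R) d
    (X : {mfun Omega >-> R}) (f : R -> \bar R) :
  (0 < d)%N -> chi_distributed P d X ->
  measurable_fun setT f -> (forall x, 0 <= f x)%E ->
  (\int[distribution P X]_x f x =
   \int[mu]_(x in posR) (f x * (chi_pdf d x)%:E))%E.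
Proof.
move=> d0 [_ chiX] mf f0.
(* [lebesgue_measure] lives on [measurableTypeR R], whose structure is not
   syntactically the canonical one of [R]: the law of [X] is retyped. *)
have mX : measurable_fun setT (X : Omega -> measurableTypeR R).
  exact: (measurable_funP X).
pose X' : {mfun Omega >-> measurableTypeR R} :=
  @mfun_Sub _ _ Omega (measurableTypeR R) X (mem_set mX).
rewrite ge0_integral_distribution //.
transitivity (\int[distribution P X']_x f x)%E.
  by rewrite ge0_integral_distribution.
apply: (@ge0_integral_density _ (measurableTypeR R) R (distribution P X') mu posR
  (@chi_pdf R d)) => //.
- by apply: measurable_funTS; exact: measurable_chi_pdf.
- by move=> z; exact: chi_pdf_ge0.
Qed.

(** Tonelli's theorem only asks the whole polynomial to be nonnegative; single coefficients may be
    negative, as happens for SimRFs. *)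
Lemma integral_poly2_independent_chi (dT : measure_display)
    (Omega : measurableType dT) (P : probability Omega R) d
    (X Y : {mfun Omega >-> R}) (I : finType) (c : I -> R) (a b : I -> nat) :
  (0 < d)%N -> chi_distributed P d X -> chi_distributed P d Y ->
  (forall A B : set R, measurable A -> measurable B ->
    (P (X @^-1` A `&` Y @^-1` B) = P (X @^-1` A) * P (Y @^-1` B))%E) ->
  (forall x y, 0 <= \sum_i c i * x ^+ a i * y ^+ b i) ->
  (\int[P]_w (\sum_i c i * X w ^+ a i * Y w ^+ b i)%:E =
   (\sum_i c i * chi_moment d (a i) * chi_moment d (b i))%:E)%E.
Proof.
move=> d0 chiX chiY XY h0.
rewrite (ge0_integral_independent_pair _ _ _ _ _ _ XY
  (fun x y => (\sum_i c i * x ^+ a i * y ^+ b i)%:E)); last 2 first.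
- apply/measurable_EFinP; apply: measurable_sum => i.
  apply: measurable_funM; last by apply: measurable_funX; exact: measurable_snd.
  by apply: measurable_funM => //; apply: measurable_funX; exact: measurable_fst.
- by move=> x y; rewrite lee_fin.
have inner x : (\int[distribution P Y]_y (\sum_i c i * x ^+ a i * y ^+ b i)%:E =
    (\sum_i (c i * chi_moment d (b i)) * x ^+ a i)%:E)%E.
  rewrite (ge0_integral_chi_distributed _ _ _ d) //.
  - under eq_integral do rewrite -EFinM.
    rewrite integral_sum_expr_chi_pdf //; congr EFin; apply: eq_bigr => i _.
    by rewrite mulrAC.
  - apply/measurable_EFinP; apply: measurable_sum => i.
    by apply: measurable_funM => //; exact: exprn_measurable.
  - by move=> y; rewrite lee_fin.
under eq_integral do rewrite inner.
rewrite (ge0_integral_chi_distributed _ _ _ d) //.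
- under eq_integral do rewrite -EFinM.
  rewrite integral_sum_expr_chi_pdf //; congr EFin; apply: eq_bigr => i _.
  by rewrite mulrAC.
- apply/measurable_EFinP; apply: measurable_sum => i.
  by apply: measurable_funM => //; exact: exprn_measurable.
(* The sign cannot be read off the coefficients; it is inherited from the integrand through
   [inner]. *)
- by move=> x; rewrite -inner; apply: integral_ge0 => y _; rewrite lee_fin.
Qed.

End chi_moments.

(** * Moments of the quadratic form *)

Section quad_moment.
Variable R : realType.

(** The squared norm of the sum of two vectors of lengths [x] and [y] whose directions have inner
    product [e]. *)
Definition quad (e x y : R) : R := x ^+ 2 + y ^+ 2 + 2 * e * x * y.

(** Two nested binomial expansions: the first isolates the power [p] of the cross term, the second
    expands [(x^2 + y^2)^(k-p)]. Vanishing binomials extend the inner sum to all of ['I_k.+1], so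
    that one finite index type suffices. *)
Lemma quad_expr (e x y : R) k :
  quad e x y ^+ k = \sum_(i : 'I_k.+1 * 'I_k.+1)
    ('C(k, i.1)%:R * 'C(k - i.1, i.2)%:R * (2 * e) ^+ i.1) *
    x ^+ (i.1 + i.2.*2) * y ^+ (i.1 + (k - i.1 - i.2).*2).
Proof.
rewrite -(pair_bigA _ (fun p a : 'I_k.+1 =>
  ('C(k, p)%:R * 'C(k - p, a)%:R * (2 * e) ^+ p) *
    x ^+ (p + a.*2) * y ^+ (p + (k - p - a).*2))) /=.
rewrite /quad exprDn; apply: eq_bigr => -[p pk] _ /=.
have {}pk : (p <= k)%N by rewrite -ltnS.
have -> : (x ^+ 2 + y ^+ 2) ^+ (k - p) = \sum_(a < k.+1)
    'C(k - p, a)%:R * (x ^+ a.*2 * y ^+ (k - p - a).*2).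
  rewrite addrC exprDn (big_ord_widen k.+1 (fun a =>
    (y ^+ 2) ^+ (k - p - a) * (x ^+ 2) ^+ a *+ 'C(k - p, a))) ?ltnS ?leq_subr //.
  rewrite big_mkcond; apply: eq_bigr => a _; case: ifPn => [_|].
    by rewrite -!exprM !mul2n -mulr_natl (mulrC (y ^+ _)).
  by rewrite -leqNgt => ka; rewrite bin_small // mul0r.
rewrite mulr_suml -sumrMnl; apply: eq_bigr => a _.
by rewrite -mulr_natl !exprD !exprMn; ring.
Qed.

Lemma quad_ge0 (e x y : R) : -1 <= e <= 1 -> 0 <= quad e x y.
Proof.
move=> /andP[e1 e2].
have -> : quad e x y = (1 + e) / 2 * (x + y) ^+ 2 + (1 - e) / 2 * (x - y) ^+ 2.
  by rewrite /quad; field.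
by rewrite addr_ge0 // mulr_ge0 ?sqr_ge0 // divr_ge0 //; lra.
Qed.

(** The difference of the two sides is [quad (- e) x y]. The bound serves to dominate every coupling
    by the orthogonal one. *)
Lemma quad_le (e x y : R) : -1 <= e <= 1 -> quad e x y <= 2 * quad 0 x y.
Proof.
move=> /andP[e1 e2].
have : 0 <= quad (- e) x y by apply: quad_ge0; apply/andP; split; lra.
by rewrite /quad; lra.
Qed.

(** The expectation of [quad e X Y ^+ k] for independent chi variables, once the sum over the powers
    of the squares is collapsed; [p] is the power of the cross term. *)
Definition quad_moment (d : nat) (e : R) (k : nat) : R :=
  2 ^+ k * \sum_(p < k.+1) 'C(k, p)%:R * (2 * e) ^+ p *
    (half_Gamma R (d + p) ^+ 2 * half_Gamma R (d + k).*2
     / (half_Gamma R (d + p).*2 * half_Gamma R d ^+ 2)).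

(** For fixed [p], the sum over [a] is the Gamma convolution at [d + p] of order [k - p]. In every
    surviving term the exponents of [Num.sqrt 2] add up to [2k]. *)
Lemma sum_chi_moments d e k : (0 < d)%N ->
  \sum_(i : 'I_k.+1 * 'I_k.+1)
    ('C(k, i.1)%:R * 'C(k - i.1, i.2)%:R * (2 * e) ^+ i.1) *
    chi_moment R d (i.1 + i.2.*2) * chi_moment R d (i.1 + (k - i.1 - i.2).*2) =
  quad_moment d e k.
Proof.
move=> d0.
rewrite -(pair_bigA _ (fun p a : 'I_k.+1 =>
  ('C(k, p)%:R * 'C(k - p, a)%:R * (2 * e) ^+ p) *
    chi_moment R d (p + a.*2) * chi_moment R d (p + (k - p - a).*2))) /=.
rewrite /quad_moment mulr_sumr; apply: eq_bigr => -[p pk] _ /=.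
have {}pk : (p <= k)%N by rewrite -ltnS.
have dp0 : (0 < d + p)%N by rewrite addn_gt0 d0.
have hdp : half_Gamma R (d + p).*2 != 0 by rewrite half_Gamma_neq0 // double_gt0.
have conv := half_Gamma_convolution R (d + p) (k - p) dp0.
transitivity ('C(k, p)%:R * (2 * e) ^+ p * 2 ^+ k / half_Gamma R d ^+ 2 *
   \sum_(a < (k - p).+1) 'C(k - p, a)%:R * half_Gamma R (d + p + a.*2) *
     half_Gamma R (d + p + (k - p - a).*2)); last first.
  have -> : \sum_(a < (k - p).+1) 'C(k - p, a)%:R * half_Gamma R (d + p + a.*2) *
     half_Gamma R (d + p + (k - p - a).*2) =
     half_Gamma R (d + p) ^+ 2 * half_Gamma R (d + k).*2 / half_Gamma R (d + p).*2.
    apply: (canRL (mulfK hdp)); rewrite conv -doubleD; congr (_ * half_Gamma _ _.*2).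
    lia.
  (* Generalising Gamma values and powers leaves [field] a purely rational identity. *)
  move: hdp (half_Gamma_neq0 R d d0) {conv}.
  move: (half_Gamma R (d + p).*2) (half_Gamma R d) (half_Gamma R (d + p)).
  move: (half_Gamma R (d + k).*2) ('C(k, p)%:R) ((2 * e) ^+ p) (2 ^+ k).
  move=> h1 b q t h2 h3 h4 h20 h30.
  by field; rewrite h20 h30.
rewrite (big_ord_widen k.+1 (fun a => 'C(k - p, a)%:R * half_Gamma R (d + p + a.*2) *
     half_Gamma R (d + p + (k - p - a).*2))) ?ltnS ?leq_subr //.
rewrite [in RHS]big_mkcond mulr_sumr; apply: eq_bigr => a _; case: ifPn; last first.
  by rewrite -leqNgt => ka; rewrite (bin_small ka) !(mulr0, mul0r).
rewrite ltnS => ak; rewrite /chi_moment.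
have -> : 2 ^+ k = Num.sqrt 2 ^+ (p + a.*2) * Num.sqrt 2 ^+ (p + (k - p - a).*2) :> R.
  rewrite -exprD -[in LHS](@sqr_sqrtr R 2) // -exprM; congr (_ ^+ _); lia.
rewrite (addnC _ d) !addnA (addnC _ d) addnA.
move: (half_Gamma_neq0 R d d0); move: (half_Gamma R d) => h h0.
move: (half_Gamma R _) (half_Gamma R _) => h1 h2.
move: (Num.sqrt 2 ^+ _) (Num.sqrt 2 ^+ _) ((2 * e) ^+ p) => s1 s2 t.
move: ('C(_, _)%:R) ('C(_, _)%:R) => b1 b2.
by field.
Qed.

Lemma quad_moment0 d k : (0 < d)%N ->
  quad_moment d 0 k = 2 ^+ k * half_Gamma R (d + k).*2 / half_Gamma R d.*2.
Proof.
move=> d0; have h := half_Gamma_neq0 R d d0.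
have h2 : half_Gamma R d.*2 != 0 by rewrite half_Gamma_neq0 // double_gt0.
rewrite /quad_moment big_ord_recl big1 => [|i _]; last by rewrite mulr0 expr0n /= mulr0 mul0r.
rewrite /= bin0 expr0 addn0; move: (half_Gamma R (d + k).*2) (2 ^+ k) h h2.
move: (half_Gamma R d.*2) (half_Gamma R d) => h3 h4 h5 t h40 h30.
by field; rewrite h30 h40.
Qed.

End quad_moment.

(** * Gram matrices of the rows *)

Section geometry.
Variable R : realType.

Lemma sqr_l2normD n (u v : 'rV[R]_n) :
  l2norm (u + v) ^+ 2 = (u *m u^T) 0 0 + (v *m v^T) 0 0 + 2 * (u *m v^T) 0 0.
Proof.
rewrite /l2norm sqr_sqrtr ?sumr_ge0 // => [|i _]; last exact: sqr_ge0.
rewrite !mxE mulr_sumr -!big_split; apply: eq_bigr => i _ /=.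
by rewrite !mxE; ring.
Qed.

(** The Gram matrix of the rows of [D S Q] is [D (S S^T) D], because [Q Q^T = 1]; the rotation thus
    disappears from the norm. *)
Lemma sqr_l2norm_scaled_rows d (w : 'I_d -> R) (S Q : 'M[R]_d) (e : R) i j :
  orthogonal_mx Q -> (S *m S^T) i i = 1 -> (S *m S^T) j j = 1 ->
  (S *m S^T) i j = e ->
  l2norm (row i (diag_mx (\row_l w l) *m S *m Q) +
          row j (diag_mx (\row_l w l) *m S *m Q)) ^+ 2 = quad R e (w i) (w j).
Proof.
move=> oQ Sii Sjj Sij; set D := diag_mx _; pose W k := row k (D *m S *m Q).
have WE k l : (W k *m (W l)^T) 0 0 = w k * w l * (S *m S^T) k l.
  transitivity (((D *m S *m Q) *m (D *m S *m Q)^T) k l).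
    by rewrite !mxE; apply: eq_bigr => r _; rewrite !mxE.
  rewrite !trmx_mul !mulmxA -(mulmxA (D *m S) Q) oQ mulmx1 -(mulmxA D).
  by rewrite /D tr_diag_mx mul_mx_diag mul_diag_mx !mxE; ring.
rewrite -/(W i) -/(W j) sqr_l2normD !WE Sii Sjj Sij /quad; ring.
Qed.

Lemma sum_delta n (i : 'I_n) (F : 'I_n -> R) : \sum_k (i == k)%:R * F k = F i.
Proof.
rewrite (bigD1 i) //= eqxx mul1r big1 ?addr0 // => k.
by rewrite eq_sym => /negbTE ->; rewrite mul0r.
Qed.

(** Each row has the form [al e_k + be o] with [o = (1,...,1,0)], so every inner product reduces to
    entries of [o] and its squared norm. *)
Lemma simplex_mx_gram d (i j : 'I_d) : (2 <= d)%N ->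
  (simplex_mx R d *m (simplex_mx R d)^T) i j =
  if i == j then 1 else - (d%:R - 1)^-1.
Proof.
case: d i j => // d i j; rewrite ltnS => d0.
(* From here [d] is the dimension minus one, and [s^2 = q^2 + 1]. *)
pose s : R := Num.sqrt d.+1%:R; pose q : R := Num.sqrt d%:R.
have d1E : d.+1%:R - 1 = d%:R :> R by rewrite -natr1 addrK.
have q2 : d%:R = q ^+ 2 by rewrite sqr_sqrtr.
have s2 : s ^+ 2 = q ^+ 2 + 1 by rewrite -q2 natr1 sqr_sqrtr.
have q0 : q != 0 by rewrite gt_eqF // sqrtr_gt0 ltr0n.
pose o (k : 'I_d.+1) : R := (k < d)%:R.
pose al (k : 'I_d.+1) : R := if (k < d)%N then s / q else 0.
pose be (k : 'I_d.+1) : R := if (k < d)%N then - ((s + 1) / q ^+ 3) else q^-1.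
have SE k l : simplex_mx R d.+1 k l = al k * (k == l)%:R + be k * o l.
  rewrite mxE /= d1E /al /be /o sqrtrM ?sqrtrV // -/s -/q.
  by case: (k < d)%N; case: (l < d)%N => /=; ring.
have oo k : o k * o k = o k by rewrite /o; case: ltnP; rewrite ?mul1r ?mul0r.
have sumo : \sum_k o k = q ^+ 2.
  rewrite big_ord_recr /= /o /= ltnn addr0 -q2 -[in RHS](card_ord d) -sum1_card natr_sum.
  by apply: eq_bigr => k _; rewrite ltn_ord.
have -> : (simplex_mx R d.+1 *m (simplex_mx R d.+1)^T) i j =
    al i * al j * (j == i)%:R + al i * be j * o i + be i * al j * o j + be i * be j * q ^+ 2.
  rewrite mxE; under eq_bigr => k _ do rewrite [in X in _ * X]mxE !SE.
  transitivity (\sum_k (i == k)%:R * (al i * (al j * (j == k)%:R + be j * o k)) +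
    (\sum_k (j == k)%:R * (be i * al j * o k) + be i * be j * \sum_k o k)).
    rewrite mulr_sumr -!big_split; apply: eq_bigr => k _ /=.
    by rewrite -[in be i * be j * _]oo; ring.
  by rewrite !sum_delta sumo; ring.
(* [e3] is the squared norm of a row other than the last, [e4] the product of two distinct such
   rows, [e5] the product of such a row with the last one. *)
have e3 : s / q * (s / q) - 2 * (s / q * ((s + 1) / q ^+ 3)) +
    ((s + 1) / q ^+ 3) ^+ 2 * q ^+ 2 = 1.
  transitivity (s ^+ 2 / q ^+ 2 - (s ^+ 2 - 1) / q ^+ 4); first by field.
  by rewrite s2; field.
have e4 : - 2 * (s / q * ((s + 1) / q ^+ 3)) +
    ((s + 1) / q ^+ 3) ^+ 2 * q ^+ 2 = - (q ^+ 2)^-1.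
  transitivity (- (s ^+ 2 - 1) / q ^+ 4); first by field.
  by rewrite s2; field.
have e5 : s / q * q^-1 - (s + 1) / q ^+ 3 * q^-1 * q ^+ 2 = - (q ^+ 2)^-1 by field.
rewrite d1E q2 /al /be /o (eq_sym j); have [ij|ij] := eqVneq i j.
  rewrite ij; case: (j < d)%N => /=; first by rewrite -[RHS]e3; field.
  by field.
case: (boolP (i < d)%N) => id; case: (boolP (j < d)%N) => jd.
- by rewrite -e4 /=; field.
- by rewrite -e5 /=; field.
- by rewrite -e5 /=; field.
- case/eqP: ij; apply/val_inj; have := ltn_ord i; have := ltn_ord j => /=; lia.
Qed.

End geometry.

(** * Pairwise independence of the radii *)

Section independence.
Variables (R : realType) (dT : measure_display) (Omega : measurableType dT).
Variable P : probability Omega R.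

(** The joint product rule is specialised to [A] at [i], [B] at [j], and the whole space for the
    other radii and for the matrix. *)
Lemma mutually_independent_pair d (ws : 'I_d -> Omega -> R) (Rm : Omega -> 'M[R]_d)
    (i j : 'I_d) (A B : set R) :
  mutually_independent P ws Rm -> i != j -> measurable A -> measurable B ->
  (P (ws i @^-1` A `&` ws j @^-1` B) = P (ws i @^-1` A) * P (ws j @^-1` B))%E.
Proof.
move=> ind ij mA mB.
pose C k : set R := if k == i then A else if k == j then B else setT.
have mC k : measurable (C k) by rewrite /C; case: eqP => // _; case: eqP.
have mT : mx_measurable ([set: 'M[R]_d]).
  exact: (@measurableT _ (g_sigma_algebraType (@mx_coord_sets R d))).
have := ind C setT mC mT.
rewrite preimage_setT setIT probability_setT mule1.
rewrite (bigD1 i) //= (bigD1 j) /=; last by rewrite eq_sym.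
rewrite big1 => [|k /andP[ki kj]]; last first.
  by rewrite /C (negbTE ki) (negbTE kj) preimage_setT probability_setT.
rewrite mule1 {2 3}/C eqxx eq_sym (negbTE ij) eqxx => <-.
congr (P _); apply/seteqP; split=> [w [Aw Bw] k _|w Cw].
  by rewrite /C /=; case: eqP => [->//|_]; case: eqP => [->|].
split.
  by have := Cw i I; rewrite /C /= eqxx.
by have := Cw j I; rewrite /C /= eqxx eq_sym (negbTE ij).
Qed.

End independence.

(** * Convergence and RF-conformity *)

Section quad_expectation.
Variables (R : realType) (dT : measure_display) (Omega : measurableType dT).
Variables (P : probability Omega R) (d : nat).
Hypothesis d0 : (0 < d)%N.

Section pair.
Variables X Y : Omega -> R.
Hypotheses (chiX : chi_distributed P d X) (chiY : chi_distributed P d Y).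
Hypothesis XY : forall A B : set R, measurable A -> measurable B ->
  (P (X @^-1` A `&` Y @^-1` B) = P (X @^-1` A) * P (Y @^-1` B))%E.

Lemma measurable_quad_expr (e : R) k :
  measurable_fun setT (fun w => quad R e (X w) (Y w) ^+ k).
Proof.
have [mX _] := chiX; have [mY _] := chiY.
apply: measurable_funX; apply: measurable_funD.
  by apply: measurable_funD; exact: measurable_funX.
by apply: measurable_funM => //; exact: measurable_funM.
Qed.

Lemma integral_quad_expr (e : R) k : -1 <= e <= 1 ->
  (\int[P]_w (quad R e (X w) (Y w) ^+ k)%:E = (quad_moment R d e k)%:E)%E.
Proof.
move=> e1; have [mX _] := chiX; have [mY _] := chiY.
under eq_integral do rewrite quad_expr.
rewrite -sum_chi_moments //.
apply: (integral_poly2_independent_chi R dT Omega P d (mfun_Sub (mem_set mX))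
  (mfun_Sub (mem_set mY)) _ _ _ _ d0 chiX chiY XY).
by move=> x y; rewrite -quad_expr exprn_ge0 // quad_ge0.
Qed.

(** For negative [e] the defining sum alternates; its sign is visible only once it is read as an
    expectation. *)
Lemma quad_moment_ge0 (e : R) k : -1 <= e <= 1 -> 0 <= quad_moment R d e k.
Proof.
move=> e1; rewrite -lee_fin -integral_quad_expr //.
by apply: integral_ge0 => w _; rewrite lee_fin exprn_ge0 // quad_ge0.
Qed.

Lemma quad_moment_le (e : R) k : -1 <= e <= 1 ->
  quad_moment R d e k <= 2 ^+ k * quad_moment R d 0 k.
Proof.
move=> e1; have z1 : -1 <= (0 : R) <= 1 by rewrite lerN10 ler01.
rewrite -lee_fin (EFinM _ (quad_moment R d 0 k)) -!integral_quad_expr //.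
rewrite -ge0_integralZl_EFin //; last 2 first.
- by move=> w _; rewrite lee_fin exprn_ge0 // quad_ge0.
- by apply/measurable_EFinP; exact: measurable_quad_expr.
apply: ge0_le_integral => //.
- by move=> w _; rewrite lee_fin exprn_ge0 // quad_ge0.
- by apply/measurable_EFinP; exact: measurable_quad_expr.
- apply/measurable_EFinP; apply: measurable_funM => //.
  exact: measurable_quad_expr.
- move=> w _; rewrite -EFinM lee_fin -exprMn; apply: lerXn2r; last exact: quad_le.
    by rewrite nnegrE quad_ge0.
  by rewrite nnegrE mulr_ge0 // quad_ge0.
Qed.

End pair.

Definition conf_coef (v : R) (k : nat) : R :=
  v ^+ (2 * k) / (2 ^+ (2 * k) * k`!%:R * Gamma (k%:R + d%:R / 2)).

Lemma Gamma_natDhalf k : Gamma (k%:R + d%:R / 2) = half_Gamma R (d + k.*2).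
Proof. by congr Gamma; rewrite natrD -muln2 natrM; field. Qed.

Lemma conf_coef_ge0 v k : 0 <= conf_coef v k.
Proof.
have h : 0 <= half_Gamma R (d + k.*2).
  by case: d d0 => // d' _; rewrite addSn; exact/ltW/half_Gamma_gt0.
rewrite /conf_coef Gamma_natDhalf; apply: divr_ge0.
  by rewrite exprM exprn_ge0 ?sqr_ge0.
by apply: mulr_ge0 => //; rewrite mulr_ge0 ?exprn_ge0.
Qed.

(** Both sides agree at [k = 0]. The ratio of consecutive terms on the left is [v^2/(k+1)] times
    [2(d+k)/(d+2k)], hence at most [2 v^2/(k+1)], the ratio of the exponential series. *)
Lemma conf_coef_bound v k :
  conf_coef v k * (2 ^+ k * quad_moment R d 0 k) <=
  (half_Gamma R d)^-1 * exp_coeff (2 * v ^+ 2) k.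
Proof.
have h0 n : 0 < half_Gamma R (d + n).
  by case: d d0 => // d' _; rewrite addSn half_Gamma_gt0.
have h20 n : 0 < half_Gamma R (d + n).*2.
  by case: d d0 => // d' _; rewrite addSn doubleS half_Gamma_gt0.
have E n : conf_coef v n * (2 ^+ n * quad_moment R d 0 n) =
  (v ^+ 2) ^+ n / n`!%:R * (half_Gamma R (d + n).*2 / half_Gamma R d.*2) / half_Gamma R (d + n.*2).
  rewrite quad_moment0 // /conf_coef Gamma_natDhalf !exprM.
  have -> : (2 ^+ 2) ^+ n = 2 ^+ n * 2 ^+ n :> R by rewrite -exprM mul2n -addnn exprD.
  have : n`!%:R != 0 :> R by rewrite pnatr_eq0 -lt0n fact_gt0.
  have : 2 ^+ n != 0 :> R by rewrite expf_neq0.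
  have := lt0r_neq0 (h0 n.*2); have := lt0r_neq0 (h20 0%N); rewrite addn0.
  move: (half_Gamma R d.*2) (half_Gamma R (d + n).*2) (half_Gamma R (d + n.*2)).
  move: (2 ^+ n) (n`!%:R) ((v ^+ 2) ^+ n) => a b c h1 h2 h3 h1n h3n an bn.
  by field; rewrite h1n h3n an bn.
elim: k => [|k IHk].
  have g0 := lt0r_neq0 (h20 0%N).
  rewrite E /exp_coeff /= !expr0; rewrite addn0 in g0 *.
  by rewrite divr1 !mul1r mulr1 divff // mul1r.
have EC : exp_coeff (2 * v ^+ 2) k.+1 =
    v ^+ 2 / k.+1%:R * 2 * exp_coeff (2 * v ^+ 2) k :> R.
  rewrite /exp_coeff /= exprS factS natrM.
  have : k`!%:R != 0 :> R by rewrite pnatr_eq0 -lt0n fact_gt0.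
  have : k.+1%:R != 0 :> R by rewrite pnatr_eq0.
  move: (k.+1%:R) (k`!%:R) (_ ^+ k) => a b c a0 b0; by field; rewrite a0 b0.
have step : conf_coef v k.+1 * (2 ^+ k.+1 * quad_moment R d 0 k.+1) =
   (v ^+ 2 / k.+1%:R * ((d + k)%:R / ((d + k.*2)%:R / 2))) *
   (conf_coef v k * (2 ^+ k * quad_moment R d 0 k)).
  have G2 : half_Gamma R (d + k.+1).*2 = (d + k)%:R * half_Gamma R (d + k).*2.
    have [n En] : exists n, (d + k)%N = n.+1 by case: d d0 => // d' _; exists (d' + k)%N.
    rewrite addnS En !doubleS half_GammaS; congr (_ * _).
    by rewrite -doubleS -muln2 natrM mulfK // pnatr_eq0.
  have G1 : half_Gamma R (d + k.+1.*2) = (d + k.*2)%:R / 2 * half_Gamma R (d + k.*2).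
    have [n En] : exists n, (d + k.*2)%N = n.+1 by case: d d0 => // d' _; exists (d' + k.*2)%N.
    by rewrite doubleS !addnS En half_GammaS.
  rewrite !E G1 G2 exprS factS natrM.
  have : (d + k.*2)%:R != 0 :> R by rewrite pnatr_eq0 -lt0n addn_gt0 d0.
  have : k`!%:R != 0 :> R by rewrite pnatr_eq0 -lt0n fact_gt0.
  have : k.+1%:R != 0 :> R by rewrite pnatr_eq0.
  have := lt0r_neq0 (h0 k.*2); have := lt0r_neq0 (h20 0%N); rewrite addn0.
  move: (half_Gamma R d.*2) (half_Gamma R (d + k).*2) (half_Gamma R (d + k.*2)).
  move: (k`!%:R) (k.+1%:R) ((d + k.*2)%:R) ((d + k)%:R) (v ^+ 2) (v ^+ 2 ^+ k).
  move=> a b c e g h h1 h2 h3 h1n h3n bn an cn.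
  by field; rewrite h1n h3n an bn cn.
rewrite step EC [leRHS]mulrCA; apply: ler_pM => //.
- by apply: mulr_ge0; rewrite !divr_ge0 // sqr_ge0.
- have g0 := h20 0%N; rewrite addn0 in g0; rewrite E.
  apply: divr_ge0; last exact: ltW.
  apply: mulr_ge0; first by rewrite divr_ge0 // exprn_ge0 // sqr_ge0.
  by rewrite divr_ge0 // ltW.
- apply: ler_wpM2l; first by rewrite divr_ge0 ?sqr_ge0.
  rewrite ler_pdivrMr; last by rewrite divr_gt0 // ltr0n addn_gt0 d0.
  by rewrite mulrC divfK // ler_nat leq_add2l -addnn leq_addr.
Qed.

End quad_expectation.

(** * Exchange of series and expectation in the RF-conformity *)

Section conformity_series.
Variables (R : realType) (dT : measure_display) (Omega : measurableType dT).
Variables (P : probability Omega R) (d : nat).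
Hypothesis d0 : (0 < d)%N.
Variables (v e : R).
Hypothesis e1 : -1 <= e <= 1.

Definition conf_term (k : nat) : R := conf_coef R d v k * quad_moment R d e k.

Section pair.
Variables X Y : Omega -> R.
Hypotheses (chiX : chi_distributed P d X) (chiY : chi_distributed P d Y).
Hypothesis XY : forall A B : set R, measurable A -> measurable B ->
  (P (X @^-1` A `&` Y @^-1` B) = P (X @^-1` A) * P (Y @^-1` B))%E.

Lemma conf_term_ge0 k : 0 <= conf_term k.
Proof.
by rewrite mulr_ge0 ?conf_coef_ge0 //; exact: (quad_moment_ge0 _ _ _ _ _ d0 _ _ chiX chiY XY).
Qed.

(** Domination in two stages: [quad_moment_le] reduces to the orthogonal case, [conf_coef_bound] to
    the exponential series. *)
Lemma is_cvg_conf_series : cvgn (series conf_term).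
Proof.
apply: (@series_le_cvg _ _ (fun k => (half_Gamma R d)^-1 * exp_coeff (2 * v ^+ 2) k)).
- exact: conf_term_ge0.
- move=> k; apply: mulr_ge0; last first.
    by apply: exp_coeff_ge0; rewrite mulr_ge0 // sqr_ge0.
  rewrite invr_ge0; by case: d d0 => // d' _; exact/ltW/half_Gamma_gt0.
- move=> k; apply: le_trans (conf_coef_bound _ _ d0 _ _).
  apply: ler_wpM2l; first exact: conf_coef_ge0.
  exact: (quad_moment_le _ _ _ _ _ d0 _ _ chiX chiY XY).
- exact/is_cvg_seriesZ/is_cvg_series_exp_coeff.
Qed.

(** Nonnegative terms let series and expectation commute; convergence then turns the extended-real
    sum into a real limit. Only even powers of the norm occur, so its square is all that has to be
    known. *)
Lemma integral_conf_series (N : Omega -> R) :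
  (forall w, N w ^+ 2 = quad R e (X w) (Y w)) ->
  (\int[P]_w conf_series d v (N w) = (limn (series conf_term))%:E)%E.
Proof.
move=> NE.
transitivity (\int[P]_w \sum_(0 <= k <oo)
    (conf_coef R d v k * quad R e (X w) (Y w) ^+ k)%:E)%E.
  apply: eq_integral => w _; apply: eq_eseriesr => k _; congr EFin.
  by rewrite /conf_coef -NE -exprM mulrAC.
rewrite integral_nneseries //; last 2 first.
- move=> k; apply/measurable_EFinP; apply: measurable_funM => //.
  exact: (measurable_quad_expr _ _ _ _ _ _ _ chiX chiY).
- by move=> k w _; rewrite lee_fin mulr_ge0 ?conf_coef_ge0 // exprn_ge0 // quad_ge0.
transitivity (\sum_(0 <= k <oo) (conf_term k)%:E)%E.
  apply: eq_eseriesr => k _; under eq_integral do rewrite EFinM.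
  rewrite ge0_integralZl_EFin //.
  - by rewrite (integral_quad_expr _ _ _ _ _ d0 _ _ chiX chiY XY).
  - by move=> w _; rewrite lee_fin exprn_ge0 // quad_ge0.
  - by apply/measurable_EFinP; exact: (measurable_quad_expr _ _ _ _ _ _ _ chiX chiY).
  - exact: conf_coef_ge0.
rewrite -EFin_lim; last exact: is_cvg_conf_series.
by congr (limn _); apply/funext => n; rewrite /= /series /= sumEFin.
Qed.

End pair.

(** The number of ordered pairs of distinct indices cancels the normalisation of the
    RF-conformity. *)
Lemma sum_distinct_pairs (m : nat) (T : R) : (m <= d)%N ->
  (\sum_(i < d | (i < m)%N) \sum_(j < d | (j < m)%N && (j != i)) T%:E =
   (m%:R * (m%:R - 1) * T)%:E)%E.
Proof.
move=> md.
have cst (c : R) : \sum_(j < d | (j < m)%N) c = m%:R * c.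
  by rewrite -(big_ord_widen d (fun=> c) md) sumr_const card_ord mulr_natl.
rewrite -mulrA -cst -sumEFin; apply: eq_bigr => i im; rewrite sumEFin; congr EFin.
by have := cst T; rewrite (bigD1 i) //= mulrBl mul1r => <-; rewrite addrAC subrr add0r.
Qed.

(** Shared by both couplings: every pair contributes the same limit, since only [e] enters. [C] is
    the constant in front of the closed form and [t] its general term; [C != 0] transfers
    convergence to [t]. *)
Lemma rf_conformity_series (m : nat) (ws : 'I_d -> Omega -> R)
    (W : 'I_d -> Omega -> 'rV[R]_d) (C : R) (t : nat -> R) :
  (2 <= m <= d)%N -> (forall i, chi_distributed P d (ws i)) ->
  (forall i j : 'I_d, i != j -> forall A B : set R, measurable A -> measurable B ->
    (P (ws i @^-1` A `&` ws j @^-1` B) = P (ws i @^-1` A) * P (ws j @^-1` B))%E) ->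
  (forall i j : 'I_d, i != j -> forall w,
    l2norm (W i w + W j w) ^+ 2 = quad R e (ws i w) (ws j w)) ->
  C != 0 -> (forall k, Gamma (d%:R / 2) * conf_term k = C * t k) ->
  exists2 r : R, rf_conformity P m W v = (C * r)%:E & series t @ \oo --> r.
Proof.
move=> /andP[m2 md] chi ind WE C0 tE.
have d2 := leq_trans m2 md.
have cs : cvgn (series conf_term).
  (* Convergence was derived from a pair of independent chi variables; the indices [0] and [1]
     supply one, as [2 <= d]. *)
  have n01 : Ordinal d0 != Ordinal d2 by [].
  exact: (is_cvg_conf_series _ _ (chi _) (chi _) (ind _ _ n01)).
have tE' : t = fun k => C^-1 * (Gamma (d%:R / 2) * conf_term k).
  by apply/funext => k; rewrite tE mulKf.
have sE : series t = fun n => C^-1 * Gamma (d%:R / 2) * series conf_term n.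
  apply/funext => n; rewrite /series /= mulr_sumr; apply: eq_bigr => k _.
  by rewrite tE' mulrA.
exists (C^-1 * Gamma (d%:R / 2) * limn (series conf_term)).
  rewrite /rf_conformity.
  transitivity ((Gamma (d%:R / 2) / (m%:R * (m%:R - 1)))%:E *
      \sum_(i < d | (i < m)%N) \sum_(j < d | (j < m)%N && (j != i))
        (limn (series conf_term))%:E)%E.
    congr (_ * _)%E; apply: eq_bigr => i _; apply: eq_bigr => j /andP[_ ji].
    have ij : i != j by rewrite eq_sym.
    exact: (integral_conf_series _ _ (chi i) (chi j) (ind _ _ ij) _ (WE _ _ ij)).
  rewrite sum_distinct_pairs // -EFinM; congr EFin.
  have m0 : m%:R != 0 :> R by rewrite pnatr_eq0 -lt0n (leq_trans _ m2).
  have m1 : m%:R - 1 != 0 :> R by rewrite subr_eq0 pnatr_eq1 gtn_eqF.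
  by field; rewrite C0 m0 m1.
by rewrite sE; apply: cvgMl_tmp.
Qed.

End conformity_series.

(** * Identification of the general terms with the two closed forms *)

Section conformity_terms.
Variable R : realType.

Lemma Gamma_natr n : Gamma (n%:R) = half_Gamma R n.*2.
Proof. by rewrite /half_Gamma -muln2 natrM mulfK // pnatr_eq0. Qed.

Lemma conf_term_orf d v k : (0 < d)%N ->
  Gamma (d%:R / 2) * conf_term R d v 0 k =
  Gamma (d%:R / 2) / Gamma d%:R * (v ^+ (2 * k) / (2 ^+ k * k`!%:R)
       * (Gamma (k%:R + d%:R) / Gamma (k%:R + d%:R / 2))).
Proof.
move=> d0; rewrite /conf_term /conf_coef quad_moment0 // Gamma_natDhalf -natrD !Gamma_natr.
rewrite (addnC k) (mulnC 2 k) (exprM 2 k) -/(half_Gamma R d).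
have : k`!%:R != 0 :> R by rewrite pnatr_eq0 -lt0n fact_gt0.
have : 2 ^+ k != 0 :> R by rewrite expf_neq0.
have : half_Gamma R d.*2 != 0 by rewrite half_Gamma_neq0 // double_gt0.
have : half_Gamma R (d + k.*2) != 0 by rewrite half_Gamma_neq0 // addn_gt0 d0.
move: (half_Gamma R d.*2) (half_Gamma R d) (half_Gamma R (d + k).*2) (half_Gamma R (d + k.*2)).
move: (k`!%:R) (2 ^+ k) (v ^+ _) => a b c h1 h2 h3 h4 h40 h10 b0 a0.
by field; rewrite h40 h10 b0 a0.
Qed.

(** Matched term by term in [p]: duplication at [d + p] turns [Gamma((d+p)/2)^2 / Gamma(d+p)] into a
    multiple of [Gamma((d+p)/2) / Gamma((d+p+1)/2)]. The [2^p] it produces cancels that of [(2e)^p],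
    and the [k!] of the binomial cancels that of the coefficient. *)
Lemma conf_term_simrf d v k : (0 < d)%N ->
  Gamma (d%:R / 2) * conf_term R d v (- (d%:R - 1)^-1) k =
  Num.sqrt pi / (Gamma (d%:R / 2) * 2 ^+ d.-1) *
  (Gamma (k%:R + d%:R) / Gamma (k%:R + d%:R / 2)
       * (v ^+ (2 * k) / 2 ^+ k)
       * \sum_(p < k.+1)
           ((- (d%:R - 1)^-1) ^+ p
            * (Gamma ((d%:R + p%:R) / 2) / Gamma ((d%:R + p%:R + 1) / 2))
            / ((k - p)`!%:R * p`!%:R))).
Proof.
move=> d0; set e := - _^-1.
rewrite /conf_term /conf_coef /quad_moment Gamma_natDhalf -natrD Gamma_natr.
rewrite (addnC k) (mulnC 2 k) (exprM 2 k) -/(half_Gamma R d) !mulr_sumr.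
apply: eq_bigr => -[p pk] _ /=; have {}pk : (p <= k)%N by rewrite -ltnS.
rewrite -natrD natr1 -/(half_Gamma R (d + p)) -/(half_Gamma R (d + p).+1).
have dp0 : (0 < d + p)%N by rewrite addn_gt0 d0.
have dup := half_Gamma_duplication R (d + p) dp0.
have -> : half_Gamma R (d + p).*2 = half_Gamma R (d + p) * half_Gamma R (d + p).+1 *
    (2 ^+ d.-1 * 2 ^+ p) / Num.sqrt pi.
  apply: (canRL (mulfK _)); first by rewrite gt_eqF // sqrtr_gt0 pi_gt0.
  apply: (@mulfI _ 2); first by rewrite pnatr_eq0.
  have e2 : 2 ^+ (d + p) = 2 * (2 ^+ d.-1 * 2 ^+ p) :> R.
    by rewrite mulrA -exprS prednK // exprD.
  transitivity (2 * Num.sqrt pi * half_Gamma R (d + p).*2); first by ring.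
  by rewrite -dup e2; ring.
have binE : 'C(k, p)%:R = k`!%:R / ((k - p)`!%:R * p`!%:R) :> R.
  apply: (canRL (mulfK _)); first by rewrite mulf_neq0 // pnatr_eq0 -lt0n fact_gt0.
  by rewrite -!natrM (mulnC (k - p)`!) bin_fact.
rewrite binE exprMn.
have : half_Gamma R d != 0 by rewrite half_Gamma_neq0.
have : half_Gamma R (d + p) != 0 by rewrite half_Gamma_neq0.
have : half_Gamma R (d + p).+1 != 0 by rewrite half_Gamma_neq0.
have : half_Gamma R (d + k.*2) != 0 by rewrite half_Gamma_neq0 // addn_gt0 d0.
have fn n : n`!%:R != 0 :> R by rewrite pnatr_eq0 -lt0n fact_gt0.
have tn n : 2 ^+ n != 0 :> R by rewrite expf_neq0.
have : Num.sqrt pi != 0 :> R by rewrite gt_eqF // sqrtr_gt0 pi_gt0.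
have := tn k; have := tn d.-1; have := tn p; have := fn k; have := fn (k - p)%N; have := fn p.
move: (half_Gamma R d) (half_Gamma R (d + p)) (half_Gamma R (d + p).+1) (half_Gamma R (d + k).*2)
  (half_Gamma R (d + k.*2)) (2 ^+ k) (2 ^+ d.-1) (2 ^+ p) (k`!%:R) ((k - p)`!%:R) (p`!%:R)
  (Num.sqrt pi) (v ^+ _) (e ^+ p).
move=> h1 h2 h3 h4 h5 t1 t2 t3 f1 f2 f3 s c g f30 f20 f10 t30 t20 t10 s0 h50 h30 h20 h10.
by field; rewrite ?f30 ?f20 ?f10 ?t30 ?t20 ?t10 ?s0 ?h50 ?h30 ?h20 ?h10.
Qed.

End conformity_terms.

(** Each sum is given as a real limit [r] of partial sums, so that convergence is asserted along
    with the value. *)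
Theorem theorem4p3 (R : realType) (dT : measure_display)
    (Omega : measurableType dT) (P : probability Omega R)
    (d m : nat) (x y : 'rV[R]_d)
    (ws : 'I_d -> Omega -> R) (Rm : Omega -> 'M[R]_d) :
  (2 <= d)%N -> (2 <= m <= d)%N ->
  (forall i, chi_distributed P d (ws i)) ->
  haar_orthogonal P Rm ->
  mutually_independent P ws Rm ->
  let v := l2norm (x + y) in
  (* ORFs: W_i = row i of diag(w_1..w_d) R *)
  let W_orf := fun (i : 'I_d) w => row i (diag_mx (\row_j ws j w) *m Rm w) in
  (* SimRFs: W_i = row i of diag(w_1..w_d) S R *)
  let W_sim := fun (i : 'I_d) w =>
    row i (diag_mx (\row_j ws j w) *m simplex_mx R d *m Rm w) in
  (exists2 r : R,
     rf_conformity P m W_orf v = (Gamma (d%:R / 2) / Gamma d%:R * r)%:E &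
     series (fun k : nat =>
       v ^+ (2 * k) / (2 ^+ k * k`!%:R)
       * (Gamma (k%:R + d%:R) / Gamma (k%:R + d%:R / 2))) @ \oo --> r) /\
  (exists2 r : R,
     rf_conformity P m W_sim v =
       (Num.sqrt pi / (Gamma (d%:R / 2) * 2 ^+ d.-1) * r)%:E &
     series (fun k : nat =>
       Gamma (k%:R + d%:R) / Gamma (k%:R + d%:R / 2)
       * (v ^+ (2 * k) / 2 ^+ k)
       * \sum_(p < k.+1)
           ((- (d%:R - 1)^-1) ^+ p
            * (Gamma ((d%:R + p%:R) / 2) / Gamma ((d%:R + p%:R + 1) / 2))
            / ((k - p)`!%:R * p`!%:R))) @ \oo --> r).
Proof.
move=> d2 md chi [_ [oR _]] ind v W_orf W_sim.
have d0 : (0 < d)%N by apply: leq_trans d2.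
have indp (i j : 'I_d) (ij : i != j) (A B : set R) :=
  @mutually_independent_pair R dT Omega P d ws Rm i j A B ind ij.
have hG n : (0 < n)%N -> Gamma (n%:R / 2) != 0 :> R by exact: half_Gamma_neq0.
have hG2 : Gamma d%:R != 0 :> R by rewrite Gamma_natr half_Gamma_neq0 // double_gt0.
have d1 : (1 : R) <= d%:R - 1.
  by rewrite lerBrDr -(natrD R 1 1) ler_nat.
split.
- apply: (rf_conformity_series _ _ _ _ _ d0 v 0 _ m ws W_orf _ _ md chi indp).
  + by rewrite lerN10 ler01.
  (* ORFs are the case where the direction matrix is the identity, whose off-diagonal Gram entries
     are [0]. *)
  + move=> i j ij w; rewrite /W_orf -(mulmx1 (diag_mx _)).
    apply: sqr_l2norm_scaled_rows.
    * exact: oR.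
    * by rewrite trmx1 mulmx1 mxE eqxx.
    * by rewrite trmx1 mulmx1 mxE eqxx.
    * by rewrite trmx1 mulmx1 mxE (negbTE ij).
  + by rewrite mulf_neq0 ?invr_neq0 // hG.
  + by move=> k; exact: conf_term_orf.
- apply: (rf_conformity_series _ _ _ _ _ d0 v (- (d%:R - 1)^-1) _ m ws W_sim _ _ md chi indp).
  (* For [d >= 2] the inner product [-1/(d-1)] lies in [[-1, 0]]. *)
  + have d10 : 0 < d%:R - 1 :> R by apply: lt_le_trans d1.
    rewrite lerN2 invf_le1 // d1 /=; apply: (@le_trans _ _ 0) => //.
    by rewrite oppr_le0 invr_ge0 ltW.
  + move=> i j ij w; apply: sqr_l2norm_scaled_rows.
    * exact: oR.
    * by rewrite simplex_mx_gram // eqxx.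
    * by rewrite simplex_mx_gram // eqxx.
    * by rewrite simplex_mx_gram // (negbTE ij).
  + rewrite mulf_neq0 ?invr_neq0 ?mulf_neq0 ?hG ?expf_neq0 ?pnatr_eq0 //.
    by rewrite gt_eqF // sqrtr_gt0 pi_gt0.
  + by move=> k; exact: conf_term_simrf.
Qed.
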